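(* Let $K\ge 1$ be an integer and let $G\in\mathcal{F}_K$, where $\mathcal{F}_K$ is the family of graphs arising from instances of the $K$-Matching Problem (defined in the context). Then $G$ is $K_{1,K+2}$-free, i.e. $G$ has no induced subgraph isomorphic to the complete bipartite graph (star) $K_{1,K+2}$.
   Context: An instance of the $K$-Matching Problem consists of finite sets $A,B$; for each $a\in A$ a family $P_a$ of subsets of $B$ such that $|j|\le K$ for all $j\in P_a$; and nonnegative real weights $w_{aj}$ ($a\in A$, $j\in P_a$) with $\sum_{j\in P_a}e^{-w_{aj}}=1$ for every $a\in A$. To such an instance one associates the graph $G=(V,E)$ with $V=\{v_{aj}:a\in A,\ j\in P_a\}$ (one vertex for each pair $(a,j)$) and $$E=\{(v_{aj},v_{aj'}) : a\in A,\ j,j'\in P_a,\ j\ne j'\}\ \cup\ \{(v_{aj},v_{a'j'}) : a,a'\in A,\ a\neq a',\ j\in P_a,\ j'\in P_{a'},\ j\cap j'\neq\emptyset\}.$$ $\mathcal{F}_K$ denotes the family of all graphs $G$ obtained in this way from any instance of the $K$-Matching Problem. *)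

(* Defs.v *)
From mathcomp Require Import all_boot all_order all_algebra.
From mathcomp Require Import reals sequences.

Set Implicit Arguments.
Unset Strict Implicit.
Unset Printing Implicit Defensive.

Import Order.TTheory GRing.Theory Num.Theory.

Record sgraph := SGraph {
  vertex :> finType;
  adj : rel vertex;
  adj_sym : symmetric adj;
  adj_irrefl : irreflexive adj
}.

Definition isomorphic (G H : sgraph) : Prop :=
  exists2 f : G -> H, bijective f & forall x y : G, adj (f x) (f y) = adj x y.

Section Induced.
Variables (G : sgraph) (S : {set G}).

Definition induced_adj : rel {x : G | x \in S} :=
  fun x y => adj (val x) (val y).

Fact induced_adj_sym : symmetric induced_adj.
Proof. by move=> x y; rewrite /induced_adj adj_sym. Qed.

Fact induced_adj_irrefl : irreflexive induced_adj.
Proof. by move=> x; rewrite /induced_adj adj_irrefl. Qed.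

Definition induced : sgraph := SGraph induced_adj_sym induced_adj_irrefl.

End Induced.

Section CompleteBipartite.
Variables m n : nat.

Definition complete_bipartite_adj : rel ('I_m + 'I_n)%type :=
  fun x y => match x, y with
             | inl _, inr _ | inr _, inl _ => true
             | _, _ => false
             end.

Fact complete_bipartite_adj_sym : symmetric complete_bipartite_adj.
Proof. by case=> ? []. Qed.

Fact complete_bipartite_adj_irrefl : irreflexive complete_bipartite_adj.
Proof. by case. Qed.

Definition complete_bipartite : sgraph :=
  SGraph complete_bipartite_adj_sym complete_bipartite_adj_irrefl.

End CompleteBipartite.

Definition induced_free (H G : sgraph) : Prop :=
  ~ exists S : {set G}, isomorphic (induced S) H.

(* [km_weight] is total; only its values at [j \in km_sets a] matter. *)
Record kmatching (R : realType) (K : nat) := KMatching {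
  km_A : finType;
  km_B : finType;
  km_sets : km_A -> {set {set km_B}};
  km_weight : km_A -> {set km_B} -> R;
  km_card : forall a j, j \in km_sets a -> (#|j| <= K)%N;
  km_weight_ge0 : forall a j, j \in km_sets a -> (0 <= km_weight a j)%R;
  km_weight_sum : forall a,
    (\sum_(j in km_sets a) expR (- km_weight a j) = 1)%R
}.

Section MatchingGraph.
Variables (R : realType) (K : nat) (I : kmatching R K).

Definition km_vertex : finType :=
  {x : km_A I * {set km_B I} | x.2 \in km_sets x.1}.

Definition km_adj : rel km_vertex := fun x y =>
  let: (a, j) := val x in
  let: (a', j') := val y in
  ((a == a') && (j != j')) || ((a != a') && (j :&: j' != set0)).

Fact km_adj_sym : symmetric km_adj.
Proof.
move=> [[a j] ?] [[a' j'] ?]; rewrite /km_adj /=.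
by rewrite (eq_sym a a') (eq_sym j j') setIC.
Qed.

Fact km_adj_irrefl : irreflexive km_adj.
Proof. by move=> [[a j] ?]; rewrite /km_adj /= !eqxx. Qed.

Definition km_graph : sgraph := SGraph km_adj_sym km_adj_irrefl.

End MatchingGraph.

(* The family is closed under graph isomorphism. *)
Definition matching_family (R : realType) (K : nat) (G : sgraph) : Prop :=
  exists I : kmatching R K, isomorphic G (km_graph I).

(* Main.v *)
(* Send each leaf of a star centred at [(a, j)] to an element shared by its set
   with [j], if there is one. Leaves without such an element all belong to [a],
   and two leaves sharing an element of [j] are equal or adjacent. So for
   pairwise non-adjacent leaves this map into [option j] is injective, and there
   are at most [#|j| + 1 <= K + 1] of them. *)
Require Import Defs.
From mathcomp Require Import all_boot all_order all_algebra.
From mathcomp Require Import reals.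

(** A vertex is determined by its pair, so distinct vertices over the same [a] carry distinct sets;
    this supplies the missing half of the first clause of [km_adj]. *)
Lemma km_adj_neq (R : realType) (K : nat) (I : kmatching R K)
    (x y : km_vertex I) :
  x != y ->
  ((val x).1 == (val y).1) || ((val x).2 :&: (val y).2 != set0) ->
  km_adj x y.
Proof.
rewrite -(inj_eq val_inj) /km_adj.
case: (val x) (val y) => [a j] [a' j'] /=.
by rewrite xpair_eqE; case: eqP => //= _ ->.
Qed.

Lemma km_star_bound (R : realType) (K n : nat) (I : kmatching R K)
    (c : km_vertex I) (leaf : 'I_n -> km_vertex I) :
  injective leaf -> (forall i, km_adj c (leaf i)) ->
  (forall i k, ~~ km_adj (leaf i) (leaf k)) -> n <= K.+1.
Proof.
move=> leaf_inj c_leaf leaf_indep.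
pose shared i := [pick x in (val c).2 :&: (val (leaf i)).2].
have same_block i k :
    ((val (leaf i)).1 == (val (leaf k)).1)
      || ((val (leaf i)).2 :&: (val (leaf k)).2 != set0) -> i = k.
  move=> ik; apply/eqP; apply: contraNT (leaf_indep i k) => neq_ik.
  by apply: km_adj_neq ik; rewrite (inj_eq leaf_inj).
have shared_none i : shared i = None -> (val c).1 = (val (leaf i)).1.
  rewrite /shared; case: pickP => // disj _; move: (c_leaf i).
  have -> : km_adj c (leaf i) = ((val c).1 == (val (leaf i)).1)
      && ((val c).2 != (val (leaf i)).2) || ((val c).1 != (val (leaf i)).1)
      && ((val c).2 :&: (val (leaf i)).2 != set0).
    by rewrite /km_adj; case: (val c) (val (leaf i)) => [? ?] [].
  (* With no common element the second clause of [km_adj] fails, so adjacency to [c] must come from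
     the first. *)
  have /eqP-> : (val c).2 :&: (val (leaf i)).2 == set0.
    by apply/eqP/setP => x; rewrite disj inE.
  by rewrite eqxx andbF orbF => /andP[/eqP].
have shared_some i x :
    shared i = Some x -> (x \in (val c).2) && (x \in (val (leaf i)).2).
  by rewrite /shared; case: pickP => // y + [<-]; rewrite inE.
have shared_inj : injective shared.
  (* A common value [Some x] puts [x] in both leaf sets; a common value [None] places both leaves
     over the [a] of [c]. *)
  move=> i k eq_ik; apply: same_block; case ei: (shared i) => [x|].
    have /andP[_ xi] := shared_some _ _ ei.
    have /andP[_ xk] := shared_some k x (etrans (esym eq_ik) ei).
    by apply/orP; right; apply/set0Pn; exists x; rewrite inE xi.
  by rewrite -(shared_none _ ei) -(shared_none k) ?eqxx // -eq_ik.
(* The value [None] accounts for the extra one in [K.+1]. *)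
have sub : [set shared i | i in 'I_n] \subset None |: (Some @: (val c).2).
  apply/subsetP => _ /imsetP[i _ ->]; rewrite !inE.
  case ei: (shared i) => [x|] //=.
  by rewrite imset_f //; case/andP: (shared_some _ _ ei).
have := subset_leq_card sub; rewrite card_imset // card_ord => /leq_trans; apply.
apply: leq_trans (leq_card_setU _ _) _; rewrite cards1 add1n ltnS.
exact: leq_trans (leq_imset_card _ _) (km_card (valP c)).
Qed.

Theorem lemma2p2 (R : realType) (K : nat) (G : sgraph) :
  (1 <= K)%N -> matching_family R K G ->
  induced_free (complete_bipartite 1 K.+2) G.
Proof.
move=> _ [I [f f_bij f_adj]] [S [h [h' hK h'K] h_adj]].
have h'_adj u v : adj (val (h' u)) (val (h' v)) = adj u v.
  by rewrite -[in RHS](h'K u) -[in RHS](h'K v) h_adj.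
suff: K.+2 <= K.+1 by rewrite ltnn.
(* The centre is the only vertex on the [inl] side; [h'] and then [f] carry the star into
   [km_graph I]. *)
apply: (@km_star_bound R K K.+2 I (f (val (h' (inl ord0))))
  (fun i => f (val (h' (inr i))))).
- by move=> i k /(bij_inj f_bij)/val_inj/(can_inj h'K)[].
- by move=> i; exact: etrans (f_adj _ _) (h'_adj _ _).
- by move=> i k; apply: negbT; exact: etrans (f_adj _ _) (h'_adj _ _).
Qed.
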